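(* Let $A$ and $B$ be associative superalgebras over a field $K$ of characteristic different from $2$, and let $B$ be an associative $A$-bimodule. Let $H:A\to B$ be a linear map of degree $0$. Then $H$ is a crossed homomorphism from $A$ to $B$ if and only if $H\in \mathrm{Hom}(A,B)$ is a Maurer--Cartan element of the differential graded Lie algebra $\left(\bigoplus_{n\ge 0}\mathrm{Hom}(A^{\otimes n},B),\ [\![-,-]\!]_1,\ d\right)$, i.e. if and only if $dH+\frac12[\![H,H]\!]_1=0$.
   Context: An associative superalgebra is a $\mathbb{Z}_2$-graded vector space $A=A_0\oplus A_1$ with a bilinear associative product satisfying $A_iA_j\subseteq A_{i+j}$ (no unit is assumed). $|a|$ denotes the $\mathbb{Z}_2$-degree of a homogeneous element $a$. A linear map of degree $0$ (an even map) is one preserving the $\mathbb{Z}_2$-grading. For associative superalgebras $A,B$, ''$B$ is an associative $A$-bimodule'' means that there are degree $0$ bilinear maps $A\otimes B\to B$, $(a,x)\mapsto a\cdot x$, and $B\otimes A\to B$, $(x,a)\mapsto x\cdot a$, such that for all $a,b\in A$, $x,y\in B$: $(ab)\cdot x=a\cdot(b\cdot x)$, $(a\cdot x)\cdot b=a\cdot(x\cdot b)$, $(x\cdot a)\cdot b=x\cdot(ab)$, $(a\cdot x)y=a\cdot(xy)$, $(x\cdot a)y=x(a\cdot y)$, $(xy)\cdot a=x(y\cdot a)$. A crossed homomorphism $H:A\to B$ is a linear map of degree $0$ with $H(ab)=a\cdot H(b)+H(a)\cdot b+H(a)H(b)$ for all homogeneous $a,b\in A$. A homogeneous $f\in\mathrm{Hom}(A^{\otimes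 m},B)$ has bidegree $(m,\alpha_f)$, where $\alpha_f\in\mathbb{Z}_2$ is such that $|f(a_1,\dots,a_m)|=\alpha_f+|a_1|+\cdots+|a_m|$ for homogeneous $a_i$. For homogeneous $f\in\mathrm{Hom}(A^{\otimes m},B)$, $g\in\mathrm{Hom}(A^{\otimes n},B)$ and homogeneous $a_i\in A$, the bracket (extended bilinearly) is $$[\![f,g]\!]_1(a_1,\dots,a_{m+n})=(-1)^{\alpha_f\alpha_g+\alpha_f(|a_1|+\cdots+|a_n|)}\,g(a_1,\dots,a_n)\,f(a_{n+1},\dots,a_{m+n})+(-1)^{mn+1+\alpha_g(|a_1|+\cdots+|a_m|)}\,f(a_1,\dots,a_m)\,g(a_{m+1},\dots,a_{m+n}),$$ products being taken in $B$. The differential $d$, of bidegree $(1,0)$, is $$(df)(a_1,\dots,a_{m+1})=(-1)^{m-1+\alpha_f|a_1|}a_1\cdot f(a_2,\dots,a_{m+1})+f(a_1,\dots,a_m)\cdot a_{m+1}-(-1)^{m-1}\sum_{i=1}^{m}(-1)^{i-1}f(a_1,\dots,a_{i-1},a_ia_{i+1},a_{i+2},\dots,a_{m+1}).$$ A Maurer--Cartan element is an element $H$ of bidegree $(1,0)$ with $dH+\frac12[\![H,H]\!]_1=0$. *)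

(* Defs.v *)
From HB Require Import structures.
From mathcomp Require Import all_boot all_algebra.

Set Implicit Arguments.
Unset Strict Implicit.
Unset Printing Implicit Defensive.

Import GRing.Theory.
Local Open Scope ring_scope.

(* V = V_0 (+) V_1 : [homog i] is the subspace V_i, and [part i x] is a chosen
   component of x in V_i; by [homog_direct] it is the only possible one. *)
HB.mixin Record Lmodule_isSuper (K : fieldType) V of GRing.Lmodule K V := {
  homog : 'Z_2 -> V -> Prop;
  part : 'Z_2 -> V -> V;
  homog0 : forall i, homog i 0;
  homogP : forall i c x y, homog i x -> homog i y -> homog i (c *: x + y);
  part_homog : forall i x, homog i (part i x);
  part_sum : forall x, part 0 x + part 1 x = x;
  homog_direct : forall x, homog 0 x -> homog 1 x -> x = 0
}.

#[short(type="superModType")]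
HB.structure Definition SuperModule (K : fieldType) :=
  { V of GRing.Lmodule K V & Lmodule_isSuper K V }.

HB.mixin Record SuperModule_isAlgebra (K : fieldType) V of SuperModule K V := {
  smul : {bilinear V -> V -> V};
  smulA : forall a b c, smul a (smul b c) = smul (smul a b) c;
  smul_homog : forall i j a b,
    homog i a -> homog j b -> homog (i + j) (smul a b)
}.

#[short(type="superAlgType")]
HB.structure Definition SuperAlgebra (K : fieldType) :=
  { V of SuperModule K V & SuperModule_isAlgebra K V }.

Notation "a ** b" := (smul a b) (at level 40, left associativity) : ring_scope.

Record bimodule (K : fieldType) (A B : superAlgType K) := Bimodule {
  lact : {bilinear A -> B -> B};
  ract : {bilinear B -> A -> B};
  lact_homog : forall i j a x,
    homog i a -> homog j x -> homog (i + j) (lact a x);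
  ract_homog : forall i j x a,
    homog i x -> homog j a -> homog (i + j) (ract x a);
  lactM : forall a b x, lact (a ** b) x = lact a (lact b x);
  lract : forall a x b, ract (lact a x) b = lact a (ract x b);
  ractM : forall x a b, ract (ract x a) b = ract x (a ** b);
  lact_smul : forall a x y, lact a x ** y = lact a (x ** y);
  ract_smul : forall x a y, ract x a ** y = x ** lact a y;
  smul_ract : forall x y a, ract (x ** y) a = x ** ract y a
}.

Definition degree0 (K : fieldType) (V W : superModType K) (h : V -> W) : Prop :=
  forall i x, homog i x -> homog i (h x).

Definition crossed_hom (K : fieldType) (A B : superAlgType K)
    (M : bimodule A B) (H : {linear A -> B}) : Prop :=
  degree0 H /\
  forall i j a b, homog i a -> homog j b ->
    H (a ** b) = lact M a (H b) + ract M (H a) b + H a ** H b.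

Definition upd n (T : Type) (a : {ffun 'I_n -> T}) (i : 'I_n) (x : T) :
    {ffun 'I_n -> T} :=
  [ffun j => if j == i then x else a j].

Definition multilinear (K : fieldType) (V W : lmodType K) n
    (f : {ffun 'I_n -> V} -> W) : Prop :=
  forall a i, linear (fun x => f (upd a i x)).

(* The space of linear maps from the n-th tensor power of V to W. *)
Record hom (K : fieldType) (V W : lmodType K) (n : nat) := Hom {
  hom_fun :> {ffun 'I_n -> V} -> W;
  hom_multilinear : multilinear hom_fun
}.

Definition pull k n (T : Type) (s : 'I_k -> 'I_n) (a : {ffun 'I_n -> T}) :
    {ffun 'I_k -> T} :=
  [ffun i => a (s i)].

Definition parts (K : fieldType) (V : superModType K) n
    (e : {ffun 'I_n -> 'Z_2}) (a : {ffun 'I_n -> V}) : {ffun 'I_n -> V} :=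
  [ffun i => part (e i) (a i)].

Definition homogs (K : fieldType) (V : superModType K) n
    (e : {ffun 'I_n -> 'Z_2}) (a : {ffun 'I_n -> V}) : Prop :=
  forall i, homog (e i) (a i).

(* |a_1| + ... + |a_n| when e lists the degrees of the a_i. *)
Definition tdeg n (e : {ffun 'I_n -> 'Z_2}) : 'Z_2 := \sum_i e i.

Definition has_degree (K : fieldType) (V W : superModType K) n
    (alpha : 'Z_2) (f : {ffun 'I_n -> V} -> W) : Prop :=
  forall e a, homogs e a -> homog (alpha + tdeg e) (f a).

(* [mext F] is the multilinear map given by the formula [F e a] on tuples [a] of
   homogeneous elements of respective degrees [e] (see [mext_homog]). *)
Definition mext (K : fieldType) (V W : superModType K) n
    (F : {ffun 'I_n -> 'Z_2} -> {ffun 'I_n -> V} -> W)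
    (a : {ffun 'I_n -> V}) : W :=
  \sum_(e : {ffun 'I_n -> 'Z_2}) F e (parts e a).

Definition sgn (K : fieldType) (e : 'Z_2) : K := (-1) ^+ e.

Section PartTheory.
Variables (K : fieldType) (V : superModType K).
Implicit Types (x y : V) (i j : 'Z_2).

Lemma homogZ i c x : homog i x -> homog i (c *: x).
Proof. by move=> hx; rewrite -[c *: x]addr0; apply: homogP => //; apply: homog0. Qed.

Lemma homogD i x y : homog i x -> homog i y -> homog i (x + y).
Proof. by move=> hx hy; rewrite -[x]scale1r; apply: homogP. Qed.

Lemma homogB i x y : homog i x -> homog i y -> homog i (x - y).
Proof. by move=> hx hy; rewrite addrC -scaleN1r; apply: homogP. Qed.

Lemma Z2_cases i : (i == 0) || (i == 1).
Proof. by case: i => [[|[|m]] Hm]. Qed.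

Lemma part_unique x x0 x1 : homog 0 x0 -> homog 1 x1 -> x0 + x1 = x ->
  part 0 x = x0 /\ part 1 x = x1.
Proof.
move=> h0 h1 e; have e' : part 0 x - x0 = x1 - part 1 x.
  by apply/eqP; rewrite subr_eq addrAC eq_sym subr_eq part_sum addrC e.
have z : part 0 x - x0 = 0.
  apply: homog_direct; first by apply: homogB => //; apply: part_homog.
  by rewrite e'; apply: homogB => //; apply: part_homog.
split; first by apply/eqP; rewrite -subr_eq0 z.
by apply/eqP; rewrite eq_sym -subr_eq0 -e' z.
Qed.

Lemma part_linear i : linear (@part K V i).
Proof.
move=> c x y; have [] := @part_unique (c *: x + y)
  (c *: part 0 x + part 0 y) (c *: part 1 x + part 1 y).
- by apply: homogP; apply: part_homog.
- by apply: homogP; apply: part_homog.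
- by rewrite addrACA -scalerDr !part_sum.
by move=> e0 e1; case/orP: (Z2_cases i) => /eqP->.
Qed.

HB.instance Definition _ i :=
  GRing.isLinear.Build K V V _ (@part K V i) (part_linear i).

Lemma part_id i j x : homog i x -> part j x = if j == i then x else 0.
Proof.
move=> hx; case/orP: (Z2_cases i) hx => /eqP-> hx.
  have [e0 e1] := @part_unique x x 0 hx (homog0 1) (addr0 x).
  by case/orP: (Z2_cases j) => /eqP->.
have [e0 e1] := @part_unique x 0 x (homog0 0) hx (add0r x).
by case/orP: (Z2_cases j) => /eqP->.
Qed.

End PartTheory.

Section Multilinear.
Variable K : fieldType.

Lemma pull_upd_in k n (T : Type) (s : 'I_k -> 'I_n) (a : {ffun 'I_n -> T}) j x :
  injective s -> pull s (upd a (s j) x) = upd (pull s a) j x.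
Proof. by move=> sI; apply/ffunP => l; rewrite !ffunE (inj_eq sI). Qed.

Lemma pull_upd_out k n (T : Type) (s : 'I_k -> 'I_n) (a : {ffun 'I_n -> T}) i x :
  (forall j, s j != i) -> pull s (upd a i x) = pull s a.
Proof. by move=> sN; apply/ffunP => l; rewrite !ffunE (negbTE (sN l)). Qed.

Lemma parts_upd (V : superModType K) n (e : {ffun 'I_n -> 'Z_2})
    (a : {ffun 'I_n -> V}) i x :
  parts e (upd a i x) = upd (parts e a) i (part (e i) x).
Proof. by apply/ffunP => l; rewrite !ffunE; case: eqP => // ->. Qed.

Lemma ml_scale (V W : lmodType K) n c (f : {ffun 'I_n -> V} -> W) :
  multilinear f -> multilinear (fun a => c *: f a).
Proof.
by move=> hf a i b x y; rewrite hf scalerDr !scalerA [c * b]mulrC.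
Qed.

Lemma ml_add (V W : lmodType K) n (f g : {ffun 'I_n -> V} -> W) :
  multilinear f -> multilinear g -> multilinear (fun a => f a + g a).
Proof. by move=> hf hg a i b x y; rewrite hf hg scalerDr addrACA. Qed.

Lemma ml_sum (V W : lmodType K) n (I : finType)
    (F : I -> {ffun 'I_n -> V} -> W) :
  (forall e, multilinear (F e)) -> multilinear (fun a => \sum_e F e a).
Proof.
move=> hF a i b x y; rewrite scaler_sumr -big_split /=.
by apply: eq_bigr => e _; rewrite hF.
Qed.

Lemma ml_linear (U V W : lmodType K) n (g : {linear V -> W})
    (f : {ffun 'I_n -> U} -> V) :
  multilinear f -> multilinear (fun a => g (f a)).
Proof. by move=> hf a i b x y; rewrite hf linearP. Qed.

Lemma ml_parts (V : superModType K) (W : lmodType K) n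
    (e : {ffun 'I_n -> 'Z_2}) (f : {ffun 'I_n -> V} -> W) :
  multilinear f -> multilinear (fun a => f (parts e a)).
Proof. by move=> hf a i b x y; rewrite !parts_upd linearP hf. Qed.

Lemma ml_mext (V W : superModType K) n
    (F : {ffun 'I_n -> 'Z_2} -> {ffun 'I_n -> V} -> W) :
  (forall e, multilinear (F e)) -> multilinear (mext F).
Proof. by move=> hF; apply: ml_sum => e; apply: ml_parts. Qed.

Lemma ml_bilinear (V U1 U2 W : lmodType K) k l n (P : {bilinear U1 -> U2 -> W})
    (s : 'I_k -> 'I_n) (t : 'I_l -> 'I_n)
    (f : {ffun 'I_k -> V} -> U1) (g : {ffun 'I_l -> V} -> U2) :
  injective s -> injective t -> (forall i j, s i != t j) ->
  (forall r, (exists i, r = s i) \/ (exists j, r = t j)) ->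
  multilinear f -> multilinear g ->
  multilinear (fun a => P (f (pull s a)) (g (pull t a))).
Proof.
move=> sI tI st cov hf hg a r b x y; case: (cov r) => [[i ->]|[j ->]].
  have tN j : t j != s i by rewrite eq_sym.
  by rewrite !pull_upd_in ?(pull_upd_out _ _ tN) // hf linearPl.
by rewrite !pull_upd_in ?(pull_upd_out _ _ (st^~ j)) // hg linearPr.
Qed.

Lemma ml_zero (V W : lmodType K) n (f : {ffun 'I_n -> V} -> W)
    (a : {ffun 'I_n -> V}) (i : 'I_n) :
  multilinear f -> a i = 0 -> f a = 0.
Proof.
move=> hf ai; have -> : a = upd a i (0 *: 0 + 0).
  by apply/ffunP => j; rewrite ffunE scaler0 addr0; case: eqP => // ->.
have := hf a i (-1) 0 0; rewrite scaler0 addr0 => e.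
by rewrite scaler0 addr0 e scaleN1r addNr.
Qed.

Lemma mext_homog (V W : superModType K) n
    (F : {ffun 'I_n -> 'Z_2} -> {ffun 'I_n -> V} -> W) e a :
  (forall e', multilinear (F e')) -> homogs e a -> mext F a = F e a.
Proof.
move=> hF ha; rewrite /mext (bigD1 e) //= big1 ?addr0.
  by congr F; apply/ffunP => i; rewrite ffunE (part_id _ (ha i)) eqxx.
move=> e' ne; have [i ei] : exists i, e' i != e i.
  apply/existsP; rewrite -negb_forall; apply: contra ne => /forallP h.
  by apply/eqP/ffunP => i; apply/eqP/h.
by apply: (ml_zero (i := i)) => //; rewrite ffunE (part_id _ (ha i)) (negbTE ei).
Qed.

End Multilinear.

Section Operations.
Variables (K : fieldType) (A B : superAlgType K) (M : bimodule A B).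

(* The component of degree [alpha] of [f]. *)
Definition hcomp_fun n alpha (f : hom A B n) : {ffun 'I_n -> A} -> B :=
  mext (fun e a => part (alpha + tdeg e) (f a)).

Lemma hcomp_ml n alpha (f : hom A B n) : multilinear (hcomp_fun alpha f).
Proof. by apply: ml_mext => e; apply: ml_linear; apply: hom_multilinear. Qed.

Definition hcomp n alpha (f : hom A B n) : hom A B n := Hom (hcomp_ml alpha f).

Lemma hcomp_homog n alpha (f : hom A B n) e a :
  homogs e a -> hcomp alpha f a = part (alpha + tdeg e) (f a).
Proof.
move=> ha; rewrite /= /hcomp_fun (mext_homog _ ha) // => e'.
by apply: ml_linear; apply: hom_multilinear.
Qed.

Lemma hcomp_id n alpha beta (f : hom A B n) e a :
  has_degree alpha f -> homogs e a ->
  hcomp beta f a = if beta == alpha then f a else 0.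
Proof.
move=> hf ha; rewrite (hcomp_homog _ _ ha) (part_id _ (hf _ _ ha)).
by rewrite (inj_eq (addIr _)).
Qed.

(* Positions of the first [k] and of the last [l] of [k + l] arguments, then of
   the first [n] and of the last [m] of [m + n] arguments. *)
Definition fst_pos k l : 'I_k -> 'I_(k + l) := @lshift k l.
Definition lst_pos k l : 'I_l -> 'I_(k + l) := @rshift k l.
Definition fst_pos' m n (i : 'I_n) : 'I_(m + n) :=
  cast_ord (addnC n m) (lshift m i).
Definition lst_pos' m n (i : 'I_m) : 'I_(m + n) :=
  cast_ord (addnC n m) (rshift n i).

(* Meaningful for homogeneous [f], [g], [a] of degrees [alpha], [beta], [e]; it
   is extended multilinearly below, and [bracketE] shows that the extension
   agrees with it on homogeneous data. *)
Definition bracket_formula m n (alpha beta : 'Z_2) (f : hom A B m) (g : hom A B n)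
    (e : {ffun 'I_(m + n) -> 'Z_2}) (a : {ffun 'I_(m + n) -> A}) : B :=
  sgn K (alpha * beta + alpha * tdeg (pull (@fst_pos' m n) e)) *:
    (g (pull (@fst_pos' m n) a) ** f (pull (@lst_pos' m n) a))
  + sgn K ((m * n + 1)%:R + beta * tdeg (pull (@fst_pos m n) e)) *:
    (f (pull (@fst_pos m n) a) ** g (pull (@lst_pos m n) a)).

Lemma bracket_formula_ml m n alpha beta (f : hom A B m) (g : hom A B n) e :
  multilinear (bracket_formula alpha beta f g e).
Proof.
apply: ml_add; apply: ml_scale.
  apply: (@ml_bilinear K A B B B n m _ smul); try exact: hom_multilinear.
  - by move=> i j /cast_ord_inj /lshift_inj.
  - by move=> i j /cast_ord_inj /rshift_inj.
  - by move=> i j; rewrite (inj_eq (@cast_ord_inj _ _ _)) eq_lrshift.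
  - move=> r; rewrite -[r](cast_ordKV (addnC n m)).
    by case: (split_ordP (cast_ord (esym (addnC n m)) r)) => i ->;
      [left | right]; exists i.
apply: (@ml_bilinear K A B B B m n _ smul); try exact: hom_multilinear.
- exact: lshift_inj.
- exact: rshift_inj.
- by move=> i j; rewrite eq_lrshift.
- by move=> r; case: (split_ordP r) => i ->; [left | right]; exists i.
Qed.

Definition bracket_fun m n (f : hom A B m) (g : hom A B n) :
    {ffun 'I_(m + n) -> A} -> B :=
  fun a => \sum_alpha \sum_beta
    mext (bracket_formula alpha beta (hcomp alpha f) (hcomp beta g)) a.

Lemma bracket_ml m n (f : hom A B m) (g : hom A B n) :
  multilinear (bracket_fun f g).
Proof.
apply: ml_sum => alpha; apply: ml_sum => beta; apply: ml_mext => e.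
exact: bracket_formula_ml.
Qed.

Definition bracket m n (f : hom A B m) (g : hom A B n) : hom A B (m + n) :=
  Hom (bracket_ml f g).

Lemma homogs_pull k n (s : 'I_k -> 'I_n) e (a : {ffun 'I_n -> A}) :
  homogs e a -> homogs (pull s e) (pull s a).
Proof. by move=> ha i; rewrite !ffunE. Qed.

Lemma bracketE m n alpha beta (f : hom A B m) (g : hom A B n) e a :
  has_degree alpha f -> has_degree beta g -> homogs e a ->
  bracket f g a = bracket_formula alpha beta f g e a.
Proof.
move=> hf hg ha; have hp k (s : 'I_k -> _) := homogs_pull s ha.
have E al be : mext (bracket_formula al be (hcomp al f) (hcomp be g)) a =
    if (al == alpha) && (be == beta) then bracket_formula al be f g e a else 0.
  rewrite (mext_homog _ ha) => [|e']; last exact: bracket_formula_ml.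
  rewrite /bracket_formula !(hcomp_id _ hf (hp _ _)) !(hcomp_id _ hg (hp _ _)).
  by case: eqP; case: eqP => //= *; rewrite ?linear0l ?linear0r !scaler0 addr0.
rewrite /= /bracket_fun (bigD1 alpha) //= [X in _ + X]big1 ?addr0.
  rewrite (bigD1 beta) //= big1 ?addr0 => [|be nb]; first by rewrite E !eqxx.
  by rewrite E (negbTE nb) andbF.
by move=> al na; rewrite big1 // => be _; rewrite E (negbTE na).
Qed.

(* (a_1, ..., a_{i-1}, a_i a_{i+1}, a_{i+2}, ...), with [i] counted from 0. *)
Definition contract m (i : 'I_m) (a : {ffun 'I_m.+1 -> A}) : {ffun 'I_m -> A} :=
  [ffun j : 'I_m =>
    if (j < i)%N then a (lift ord_max j)
    else if j == i then a (lift ord_max j) ** a (lift ord0 j)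
    else a (lift ord0 j)].

(* [lift ord0] shifts positions by one and [lift ord_max] preserves them; the
   sign (-1)^(m-1) is written (-1)^(m+1), which also makes sense for m = 0.
   As for the bracket, this is for homogeneous data; see [diffE]. *)
Definition diff_formula m (alpha : 'Z_2) (f : hom A B m)
    (e : {ffun 'I_m.+1 -> 'Z_2}) (a : {ffun 'I_m.+1 -> A}) : B :=
  sgn K ((m + 1)%:R + alpha * e ord0) *:
    lact M (a ord0) (f (pull (lift ord0) a))
  + ract M (f (pull (lift ord_max) a)) (a ord_max)
  - (-1) ^+ (m + 1) *: \sum_(i < m) (-1) ^+ i *: f (contract i a).

Lemma pull_cst n (i : 'I_n) (a : {ffun 'I_n -> A}) :
  pull (fun _ : 'I_1 => i) a ord0 = a i.
Proof. by rewrite ffunE. Qed.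

Lemma contract_upd m (i : 'I_m) (a : {ffun 'I_m.+1 -> A}) r :
  exists j (b : {ffun 'I_m -> A}) (psi : {linear A -> A}),
    forall x, contract i (upd a r x) = upd b j (psi x).
Proof.
have E0 (l : 'I_m) : lift ord0 l = l.+1 :> nat by [].
have EM (l : 'I_m) : lift ord_max l = l :> nat.
  by rewrite /= /bump leqNgt ltn_ord.
have Q0 (l : 'I_m) : (lift ord0 l == r) = (l.+1 == r :> nat) by [].
have QM (l : 'I_m) : (lift ord_max l == r) = (l == r :> nat) by rewrite -(EM l).
have QI (l l' : 'I_m) : (l == l') = (l == l' :> nat) by [].
have [ri|ir] := leqP r i; [have rm := leq_ltn_trans ri (ltn_ord i) |].
  exists (Ordinal rm), (contract i a).
  have [rli|eri] := ltnP r i.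
    exists idfun => x; apply/ffunP => l; rewrite !ffunE Q0 QM !QI /=.
    have [->|nlr] := eqVneq (l : nat) r; first by rewrite rli.
    case: (ltnP l i) => // il; rewrite (gtn_eqF (leq_trans rli (leqW il))) //.
  have {ri eri} eri : r = i :> nat by apply/eqP; rewrite eqn_leq ri.
  exists (applyr smul (a (lift ord0 i))) => x; apply/ffunP => l.
  rewrite !ffunE Q0 QM !QI /= eri.
  case: (ltngtP l i) => [//|li|li].
    by rewrite gtn_eqF // ltnW.
  by have -> : l = i by [apply: val_inj]; rewrite gtn_eqF.
have r0 : (0 < r)%N by apply: leq_ltn_trans ir.
have rm : (r.-1 < m)%N by rewrite -ltnS prednK.
have er : r = r.-1.+1 :> nat by rewrite prednK.
exists (Ordinal rm), (contract i a).
have [eri|nri] := eqVneq r.-1 i.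
  exists (smul (a (lift ord_max i))) => x; apply/ffunP => l.
  rewrite !ffunE Q0 QM !QI /= eri er eri eqSS.
  case: (ltngtP l i) => [li|//|li].
    by rewrite ltn_eqF // ltnW.
  by have -> : l = i by [apply: val_inj]; rewrite ltn_eqF.
have il : (i < r.-1)%N by rewrite ltn_neqAle eq_sym nri -ltnS prednK.
exists idfun => x; apply/ffunP => l; rewrite !ffunE Q0 QM !QI /= er eqSS.
case: (ltngtP l i) => [li|li|li] //.
  by rewrite !ltn_eqF // (ltn_trans li) // ltnS ltnW.
by rewrite li !ltn_eqF // ltnS ltnW.
Qed.

Lemma contract_ml m (f : hom A B m) i : multilinear (fun a => f (contract i a)).
Proof.
move=> a r c x y; have [j [b [psi E]]] := contract_upd i a r.
by rewrite !E linearP hom_multilinear.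
Qed.

Lemma diff_formula_ml m alpha (f : hom A B m) e :
  multilinear (diff_formula alpha f e).
Proof.
have ml1 : multilinear (fun b : {ffun 'I_1 -> A} => b ord0).
  by move=> b j c x y; rewrite !ffunE (ord1 j).
apply: ml_add; first apply: ml_add; first apply: ml_scale.
- have ml : multilinear (fun a : {ffun 'I_m.+1 -> A} =>
      lact M (pull (fun _ : 'I_1 => ord0) a ord0) (f (pull (lift ord0) a))).
    apply: (@ml_bilinear K A A B B 1 m _ _ _ _ (fun b => b ord0) f).
    + by move=> i j _; rewrite !ord1.
    + exact: lift_inj.
    + by move=> i j; apply: neq_lift.
    + move=> p; case: (unliftP ord0 p) => [j|] ->; first by right; exists j.
      by left; exists ord0.
    + exact: ml1.
    + exact: hom_multilinear.
  by move=> a r c x y; have := ml a r c x y; rewrite !pull_cst.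
- have ml : multilinear (fun a : {ffun 'I_m.+1 -> A} =>
      ract M (f (pull (lift ord_max) a)) (pull (fun _ : 'I_1 => ord_max) a ord0)).
    apply: (@ml_bilinear K A B A B m 1 _ _ _ _ f (fun b => b ord0)).
    + exact: lift_inj.
    + by move=> i j _; rewrite !ord1.
    + by move=> i j; rewrite eq_sym; apply: neq_lift.
    + move=> p; case: (unliftP ord_max p) => [j|] ->; first by left; exists j.
      by right; exists ord0.
    + exact: hom_multilinear.
    + exact: ml1.
  by move=> a r c x y; have := ml a r c x y; rewrite !pull_cst.
have ml : multilinear (fun a : {ffun 'I_m.+1 -> A} =>
    - (-1) ^+ (m + 1) *: \sum_(i < m) (-1) ^+ i *: f (contract i a)).
  by apply: ml_scale; apply: ml_sum => i; apply: ml_scale; apply: contract_ml.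
by move=> a r c x y; have := ml a r c x y; rewrite !scaleNr.
Qed.

Definition diff_fun m (f : hom A B m) : {ffun 'I_m.+1 -> A} -> B :=
  fun a => \sum_alpha mext (diff_formula alpha (hcomp alpha f)) a.

Lemma diff_ml m (f : hom A B m) : multilinear (diff_fun f).
Proof. by apply: ml_sum => alpha; apply: ml_mext => e; apply: diff_formula_ml. Qed.

Definition diff m (f : hom A B m) : hom A B m.+1 := Hom (diff_ml f).

Lemma homogs_contract m (i : 'I_m) e (a : {ffun 'I_m.+1 -> A}) :
  homogs e a -> exists e', homogs e' (contract i a).
Proof.
move=> ha; exists [ffun j : 'I_m => if (j < i)%N then e (lift ord_max j)
  else if j == i then e (lift ord_max j) + e (lift ord0 j) else e (lift ord0 j)].
move=> j; rewrite !ffunE; case: ifP => // _; case: ifP => // _.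
exact: smul_homog.
Qed.

Lemma diffE m alpha (f : hom A B m) e a :
  has_degree alpha f -> homogs e a -> diff f a = diff_formula alpha f e a.
Proof.
move=> hf ha; have hp k (s : 'I_k -> _) := homogs_pull s ha.
have E al : mext (diff_formula al (hcomp al f)) a =
    if al == alpha then diff_formula al f e a else 0.
  rewrite (mext_homog _ ha) => [|e']; last exact: diff_formula_ml.
  rewrite /diff_formula !(hcomp_id _ hf (hp _ _)).
  under eq_bigr => i _ do
    (have [e' he'] := homogs_contract i ha; rewrite (hcomp_id _ hf he')).
  case: eqP => // _; rewrite linear0l linear0r scaler0 add0r.
  by rewrite big1 ?scaler0 ?subr0 // => i _; rewrite scaler0.
rewrite /= /diff_fun (bigD1 alpha) //= big1 ?addr0 => [|al na].
  by rewrite E eqxx.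
by rewrite E (negbTE na).
Qed.

Definition maurer_cartan (h : hom A B 1) : Prop :=
  has_degree 0 h /\ forall a, diff h a + 2^-1 *: bracket h h a = 0.

Definition hom1_fun (H : {linear A -> B}) : {ffun 'I_1 -> A} -> B :=
  fun a => H (a ord0).

Lemma hom1_ml (H : {linear A -> B}) : multilinear (hom1_fun H).
Proof. by move=> a i c x y; rewrite /hom1_fun !ffunE (ord1 i) /= linearP. Qed.

Definition hom1 (H : {linear A -> B}) : hom A B 1 := Hom (hom1_ml H).

End Operations.

(* Main.v *)
Require Import Defs.
From HB Require Import structures.
From mathcomp Require Import all_boot all_algebra.

Set Implicit Arguments.
Unset Strict Implicit.
Unset Printing Implicit Defensive.

Import GRing.Theory.
Local Open Scope ring_scope.

(** An even map [H] has bidegree (1, 0), so in every sign of the differential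
    and of the bracket the terms that involve the degrees of the arguments
    disappear, and what remains of the exponents is even. Hence on homogeneous
    [a], [b]
      (dH)(a, b) = a.H(b) + H(a).b - H(ab)  and  [[H, H]](a, b) = 2 H(a)H(b),
    and, 2 being invertible, the Maurer-Cartan expression evaluates to the
    defect a.H(b) + H(a).b + H(a)H(b) - H(ab) of the crossed homomorphism
    identity ([maurer_cartan_hom1E]).

    A crossed homomorphism is only tested on homogeneous elements whereas a
    Maurer-Cartan element is tested on all pairs, so the forward direction also
    uses that a multilinear map is determined by its values on homogeneous
    tuples ([multilinear_homog0]). *)

(** The components of the arguments are split off one position at a time: the
    induction is on the number [k] of leading positions at which the argument
    is still allowed to be inhomogeneous. *)
Lemma multilinear_homog0 (K : fieldType) (V : superModType K) (W : lmodType K)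
    n (f : {ffun 'I_n -> V} -> W) :
  multilinear f -> (forall e a, homogs e a -> f a = 0) -> forall a, f a = 0.
Proof.
move=> f_ml f0.
suff f0_from k (e : {ffun 'I_n -> 'Z_2}) (a : {ffun 'I_n -> V}) :
    (forall i : 'I_n, (k <= i)%N -> homog (e i) (a i)) -> f a = 0.
  by move=> a; apply: (f0_from n [ffun=> 0]) => i; rewrite leqNgt ltn_ord.
elim: k e a => [|k IHk] e a a_hom; first by apply: (f0 e) => i; apply: a_hom.
have [nk|kn] := leqP n k.
  by apply: (IHk e) => i ki; have := leq_trans nk ki; rewrite leqNgt ltn_ord.
pose r := Ordinal kn.
have f_part d : f (upd a r (part d (a r))) = 0.
  apply: (IHk (upd e r d)) => i; rewrite !ffunE leq_eqVlt.
  have [_ _|ir] := eqVneq i r; first exact: part_homog.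
  rewrite (_ : (k == i) = false) => [|]; first exact: a_hom.
  by rewrite eq_sym; apply: negbTE.
have -> : a = upd a r (1 *: part 0 (a r) + part 1 (a r)).
  by apply/ffunP => i; rewrite ffunE scale1r part_sum; case: eqP => // ->.
by rewrite f_ml !f_part scaler0 addr0.
Qed.

Lemma hom1_degree0 (K : fieldType) (A B : superAlgType K) (H : {linear A -> B}) :
  degree0 H -> has_degree 0 (hom1 H).
Proof. by move=> H0 e a ha; rewrite add0r /tdeg big_ord1; apply: H0. Qed.

Section EvenMap.
Variables (K : fieldType) (A B : superAlgType K) (M : bimodule A B).
Variables (H : {linear A -> B}) (H0 : degree0 H).
Variables (e : {ffun 'I_2 -> 'Z_2}) (a : {ffun 'I_2 -> A}) (ha : homogs e a).

Lemma diff_hom1E :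
  diff M (hom1 H) a =
    lact M (a ord0) (H (a ord_max)) + ract M (H (a ord0)) (a ord_max)
    - H (a ord0 ** a ord_max).
Proof.
rewrite (diffE M (hom1_degree0 H0) ha) /diff_formula big_ord1 mul0r addr0.
(* The exponent 1 + 1 of the first sign is 0 in 'Z_2 by computation, whereas
   the last sign is a genuine power of -1. *)
rewrite /sgn expr0 sqrrN expr1n !scale1r /= /hom1_fun !ffunE /=.
have -> : lift ord0 ord0 = ord_max :> 'I_2 by apply: val_inj.
by have -> : lift ord_max ord0 = ord0 :> 'I_2 by apply: val_inj.
Qed.

Lemma bracket_hom1E :
  bracket (hom1 H) (hom1 H) a = (H (a ord0) ** H (a ord_max)) *+ 2.
Proof.
rewrite (@bracketE K A B 1 1 0 0 _ _ e a (hom1_degree0 H0) (hom1_degree0 H0) ha).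
rewrite /bracket_formula !mul0r !addr0 /sgn !expr0 !scale1r.
rewrite /= /hom1_fun !ffunE mulr2n.
by congr (H (a _) ** H (a _) + H (a _) ** H (a _)); apply: val_inj.
Qed.

Lemma maurer_cartan_hom1E (charK : 2%N \notin [pchar K]) :
  diff M (hom1 H) a + 2^-1 *: bracket (hom1 H) (hom1 H) a =
    lact M (a ord0) (H (a ord_max)) + ract M (H (a ord0)) (a ord_max)
    + H (a ord0) ** H (a ord_max) - H (a ord0 ** a ord_max).
Proof.
by rewrite diff_hom1E bracket_hom1E -scaler_nat scalerA mulVf ?scale1r 1?addrAC //.
Qed.

End EvenMap.

Theorem proposition3p1 (K : fieldType) (charK : 2%N \notin [pchar K])
    (A B : superAlgType K) (M : bimodule A B)
    (H : {linear A -> B}) (H_deg0 : degree0 H) :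
  crossed_hom M H <-> maurer_cartan M (hom1 H).
Proof.
split=> [[_ HM]|[_ MC]]; split; [exact: hom1_degree0| |by []|].
  apply: multilinear_homog0 => [|e a ha].
    apply: ml_add; first exact: hom_multilinear.
    by apply: ml_scale; exact: (bracket_ml (hom1 H) (hom1 H)).
  rewrite (maurer_cartan_hom1E M H_deg0 ha charK).
  by rewrite -(HM _ _ _ _ (ha _) (ha _)) subrr.
move=> i j x y hx hy.
pose pair T (u v : T) : {ffun 'I_2 -> T} :=
  [ffun k => if k == ord0 then u else v].
have hxy : homogs (pair _ i j) (pair _ x y).
  by move=> k; rewrite !ffunE; case: eqP.
have := MC (pair _ x y); rewrite (maurer_cartan_hom1E M H_deg0 hxy charK) !ffunE /=.
by move/eqP; rewrite subr_eq0 => /eqP.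
Qed.
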